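(* Let $(A,+,\circ)$ be a strongly nilpotent brace of nilpotency index $k$ and cardinality $p^n$, where $p$ is a prime with $k<p$ and $n+1<p$. Let $(A,+,\odot)$ be the pre-Lie ring associated to this brace. Then $(A,\circ)$ is the group of flows of the pre-Lie ring $(A,+,\odot)$; that is, $a\circ b=a+e^{L_{\Omega(a)}}(b)$ for all $a,b\in A$, where $L$, $e^{L}$ and $\Omega$ are computed with respect to the product $\odot$.
   Context: A (left) brace is a set $A$ with binary operations $+,\circ$ such that $(A,+)$ is an abelian group, $(A,\circ)$ is a group, and $a\circ(b+c)+a=a\circ b+a\circ c$ for all $a,b,c$. Write $a*b=a\circ b-a-b$. For additive subgroups $X,Y$, $X*Y$ is the additive subgroup generated by all $x*y$. Set $A^{[1]}=A$, $A^{[i+1]}=\sum_{j=1}^{i}A^{[j]}*A^{[i+1-j]}$; strongly nilpotent means $A^{[m]}=0$ for some $m$, nilpotency index $k$ means $A^{[k]}=0\neq A^{[k-1]}$. Associated pre-Lie ring: let $\gamma$ be a primitive root modulo $p^p$, $\xi=\gamma^{p^{p-1}}$, $a\cdot b=\sum_{i=0}^{p-2}\xi^{p-1-i}((\xi^i a)*b)$ (with $ma$ the $m$-fold additive multiple), and $a\odot b=-(1+p+\dots+p^{n-1})(a\cdot b)$; $(A,+,\odot)$ is a pre-Lie ring (abelian group with biadditive product satisfying $(x\odot y)\odot z-x\odot(y\odot z)=(y\odot x)\odot z-y\odot(x\odot z)$). Group of flows of a left nilpotent pre-Lie ring $(A,+,\odot)$ of order $p^n$: let $A^{\mathrm{id}}=A\times\mathbb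 Z$ with $(r,m)+(s,m')=(r+s,m+m')$, $(r,m)\odot(s,m')=(r\odot s+ms+m'r,mm')$; identify $A$ with $A\times\{0\}$, put $1=(0,1)$. For $a\in A$ let $L_a(x)=a\odot x$, $e^{L_a}(x)=\sum_{j\ge0}\frac1{j!}L_a^j(x)$ (finite sum; needed factorials invertible modulo $p^n$), $W(a)=e^{L_a}(1)-1$, a bijection of $A$ with inverse $\Omega$. *)

(* Defs.v *)
From HB Require Import structures.
From mathcomp Require Import all_boot all_order all_algebra.
Set Implicit Arguments. Unset Strict Implicit. Unset Printing Implicit Defensive.
Import GRing.Theory.
Local Open Scope ring_scope.

Section Brace.
Variable A : finZmodType.
Variable circ : A -> A -> A.

Definition is_group_op : Prop :=
  (forall a b c, circ a (circ b c) = circ (circ a b) c) /\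
  exists e : A, (forall a, circ e a = a /\ circ a e = a) /\
                (forall a, exists a', circ a a' = e /\ circ a' a = e).

Definition is_brace : Prop :=
  is_group_op /\ forall a b c, circ a (b + c) + a = circ a b + circ a c.

Definition star (a b : A) : A := circ a b - a - b.

(* bmem i x  <->  x \in A^{[i]}  (for i >= 1).
   A^{[1]} = A; for i >= 2, A^{[i]} is the additive subgroup generated by
   all x * y with x \in A^{[j]}, y \in A^{[i-j]}, 1 <= j <= i-1
   (the sum of the subgroups A^{[j]} * A^{[i-j]} is the subgroup generated
   by the union of their generators). *)
Inductive bmem : nat -> A -> Prop :=
  | bmem_one x : bmem 1 x
  | bmem_gen i j x y : (0 < j)%N -> (j < i)%N -> bmem j x -> bmem (i - j) y ->
      bmem i (star x y)
  | bmem_zero i : (1 < i)%N -> bmem i 0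
  | bmem_add i x y : (1 < i)%N -> bmem i x -> bmem i y -> bmem i (x + y)
  | bmem_opp i x : (1 < i)%N -> bmem i x -> bmem i (- x).

Definition nilpotency_index (k : nat) : Prop :=
  (forall x, bmem k x -> x = 0) /\ (exists x, bmem k.-1 x /\ x <> 0).

(* "division" by d (coprime to #|A|) in A: multiplication by d^(phi(#|A|)-1),
   an inverse of d modulo #|A| (Euler), which the exponent of A divides. *)
Definition divA (d : nat) (x : A) : A := x *+ (d ^ (totient #|A|).-1).

Variables (p n gamma : nat).

Definition xi : nat := (gamma ^ (p ^ p.-1))%N.

Definition dot (a b : A) : A :=
  \sum_(i < p.-1) (star (a *+ (xi ^ i)) b) *+ (xi ^ (p.-1 - i)).

Definition odot (a b : A) : A := - (dot a b *+ (\sum_(i < n) p ^ i)%N).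

Definition mul_id (x y : A * int) : A * int :=
  (odot x.1 y.1 + y.1 *~ x.2 + x.1 *~ y.2, x.2 * y.2).

Definition L_id (a : A) (x : A * int) : A * int := mul_id (a, 0) x.

(* e^{L_a}(x) = sum_{j>=0} 1/j! L_a^j(x).  The j = 0 term is x; for j >= 1,
   L_a^j(x) lies in A x {0}, so we divide its A-component by j!.  The sum is
   truncated at j <= p-1 (the range where j! is invertible mod p^n; the
   remaining terms vanish by left nilpotency). *)
Definition exp_id (a : A) (x : A * int) : A * int :=
  (x.1 + \sum_(1 <= j < p) divA (j`!) (iter j (L_id a) x).1, x.2).

Definition expL (a b : A) : A := (exp_id a (b, 0)).1.

(* W(a) = e^{L_a}(1) - 1, with 1 = (0,1) *)
Definition W (a : A) : A := (exp_id a (0, 1)).1.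

Definition Omega (a : A) : A := odflt 0 [pick c | W c == a].

End Brace.

Definition primitive_root_mod (m g : nat) : Prop :=
  coprime g m /\
  forall e, (0 < e)%N -> (e < totient m)%N -> (g ^ e %% m <> 1 %% m)%N.

(* Main.v *)
(** Fix g and write lam_x y = y + x * y. Since g * is a nilpotent additive map,
    the binomial theorem in (A, o) makes the power g^m of g in (A, o), and
    lam_(g^m), polynomial in m, of degree less than k < p, with coefficient of
    m^j in A^[j]. Because m |-> lam_(g^m) is multiplicative, lam_(g^m) = e^(m D),
    where D is its linear coefficient, and then g = ((e^D - 1) / D)(c), where c
    is the linear coefficient of g^m. A sum over the (p-1)-st roots of unity
    xi^i extracts coefficients of such polynomials, so the product a (.) b is
    the linear coefficient of (m a) * b. The chain rule gives D = L_c, hence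
    lam_g = e^(L_c) and g = W(c). So W is surjective, and injective since A is
    finite. *)

Require Import Defs.
From HB Require Import structures.
From mathcomp Require Import all_boot all_order all_algebra.
From mathcomp Require Import all_fingroup all_solvable.
From mathcomp Require Import zify.
Set Implicit Arguments.
Unset Strict Implicit.
Unset Printing Implicit Defensive.
Import GRing.Theory.
Local Open Scope ring_scope.

(** * Orthogonality of the powers of [xi], a root of unity of order p-1 modulo p^n *)

Section TeichmullerRoot.
Local Open Scope nat_scope.
Variables p gamma : nat.
Hypothesis p_pr : prime p.

(** In z^p - 1 = (z - 1)(1 + z + ... + z^(p-1)) the second factor has p terms, each 1 modulo p, so
    every p-th power gains a factor p. *)
Lemma expn_lift_eqmod1 s y : y = 1 %[mod p] -> y ^ (p ^ s) = 1 %[mod p ^ s.+1].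
Proof.
move=> y1; have y0 : (0 < y)%N.
  by case: y y1 => // /eqP; rewrite mod0n modn_small ?prime_gt1.
elim: s => [|s IH]; first by rewrite !expn1.
set z := (y ^ (p ^ s))%N in IH.
have z0 : (0 < z)%N by rewrite expn_gt0 y0.
have z1 : z = 1 %[mod p] by rewrite -modnXm y1 modnXm exp1n.
rewrite expnSr expnM -/z; apply/eqP.
have zp : 0 < z ^ p by rewrite expn_gt0 z0.
rewrite (eqn_mod_dvd _ zp) subn1 predn_exp [(p ^ s.+2)%N]expnSr.
apply: dvdn_mul; first by rewrite -subn1 -eqn_mod_dvd //; apply/eqP.
rewrite /dvdn -modn_summ (eq_bigr (fun=> 1%N)).
  by rewrite sum_nat_const card_ord muln1 modnn.
by move=> i _; rewrite -modnXm z1 modnXm exp1n modn_small ?prime_gt1.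
Qed.

Hypothesis gammaP : primitive_root_mod (p ^ p) gamma.

Lemma xi_pred_prime : (xi p gamma) ^ p.-1 = 1 %[mod p ^ p].
Proof.
rewrite -expnM mulnC -totient_pfactor ?prime_gt0 //.
by rewrite Euler_exp_totient; case: gammaP.
Qed.

(** By Fermat, [xi] is [gamma] modulo p. If xi^r were 1 modulo p, lifting gamma^r would give
    gamma^(r p^(p-1)) = 1 modulo p^p, against primitivity. *)
Lemma xi_exp_neq1 r : (0 < r < p.-1)%N -> (xi p gamma) ^ r <> 1 %[mod p].
Proof.
move=> /andP[r0 rp] h; case: gammaP => _ /(_ (r * p ^ p.-1)%N).
have p0 := prime_gt0 p_pr.
rewrite muln_gt0 r0 expn_gt0 p0 totient_pfactor // ltn_pmul2r ?expn_gt0 ?p0 //.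
move=> /(_ isT rp); apply; rewrite expnM.
have := @expn_lift_eqmod1 p.-1 (gamma ^ r); rewrite prednK //; apply.
rewrite -h -expnM mulnC expnM.
elim: p.-1 => [|s IH]; first by rewrite expn1.
by rewrite expnSr expnM fermat_little.
Qed.

Variable n : nat.
Hypothesis n_lt_p : (n < p)%N.

Lemma xi_exp_eqmod e e' : e = e' %[mod p.-1] ->
  (xi p gamma) ^ e = (xi p gamma) ^ e' %[mod p ^ n].
Proof.
have x1 : (xi p gamma) ^ p.-1 = 1 %[mod p ^ n].
  have d : (p ^ n %| p ^ p)%N by rewrite dvdn_exp2l // ltnW.
  by rewrite -(modn_dvdm _ d) xi_pred_prime modn_dvdm.
have red m : (xi p gamma) ^ m = (xi p gamma) ^ (m %% p.-1) %[mod p ^ n].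
  rewrite {1}(divn_eq m p.-1) expnD mulnC [(_ * p.-1)%N]mulnC expnM.
  by rewrite -modnMmr -modnXm x1 modnXm exp1n modnMmr muln1.
by move=> ee; rewrite red ee -red.
Qed.

(** The terms are the powers of xi^(j-l); for j <> l their geometric sum vanishes because xi^(j-l) -
    1 is prime to p. *)
Lemma sum_xi j l : (j < p.-1)%N -> (l < p.-1)%N ->
  (\sum_(i < p.-1) (xi p gamma) ^ (i * j) * (xi p gamma) ^ (l * (p.-1 - i)))%N =
    ((j == l) * p.-1)%N %[mod p ^ n].
Proof.
move=> jp lp; set x := xi p gamma.
(* [r] is j - l modulo p-1, with [l * p.-2] standing for -l. *)
have [r [rp rE rjl]] : exists r, [/\ (r < p.-1)%N,
    j + l * p.-2 = r %[mod p.-1] & (r == 0) = (j == l)].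
  have [lj|jl] := leqP l j.
    exists (j - l)%N; split; [by lia | | by lia].
    rewrite (_ : j + l * p.-2 = l * p.-1 + (j - l))%N ?modnMDl //.
    by rewrite (_ : p.-1 = p.-2.+1); lia.
  exists (j + p.-1 - l)%N; split; [by lia | | by lia].
  rewrite (_ : j + l * p.-2 = l.-1 * p.-1 + (j + p.-1 - l))%N ?modnMDl //.
  by rewrite (_ : p.-1 = p.-2.+1); [case: l jl lp => // l; lia | lia].
have -> : (\sum_(i < p.-1) x ^ (i * j) * x ^ (l * (p.-1 - i)))%N =
    (\sum_(i < p.-1) (x ^ r) ^ i)%N %[mod p ^ n].
  rewrite -modn_summ -[RHS]modn_summ; congr (_ %% _)%N; apply: eq_bigr => i _.
  rewrite -expnD -expnM; apply: xi_exp_eqmod.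
  have E : (l * i * p.-1 + (i * j + l * (p.-1 - i)) =
            l * p.-1 + (j + l * p.-2) * i)%N.
    move: (ltn_ord i); move: (nat_of_ord i) => {}i; case: p.-1 => // q iq.
    by have := subnKC (ltnW iq); move: (q.+1 - i)%N => t /=; nia.
  by rewrite -(modnMDl (l * i)) E modnMDl -modnMml rE modnMml.
rewrite -rjl; have [-> | r0] := eqVneq r 0.
  rewrite mul1n (eq_bigr (fun=> 1%N)) ?sum1_card ?card_ord //.
  by move=> i _; rewrite expn0 exp1n.
rewrite mul0n mod0n; apply/eqP; rewrite -/(dvdn _ _).
have x0 : (0 < x ^ r)%N.
  rewrite !expn_gt0; case: gammaP => + _; case: (posnP gamma) => // ->.
  by rewrite /coprime gcd0n -[1](expn0 p) eqn_exp2l ?prime_gt1 //;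
     have := prime_gt0 p_pr; lia.
have cop : coprime (p ^ n) (x ^ r).-1.
  rewrite coprimeXl // prime_coprime // -subn1 -eqn_mod_dvd //.
  by apply/eqP; apply: xi_exp_neq1; lia.
have xp : 0 < (x ^ r) ^ p.-1 by rewrite expn_gt0 x0.
rewrite -(Gauss_dvdr _ cop) -predn_exp -subn1 -(eqn_mod_dvd _ xp).
rewrite -expnM; apply/eqP; rewrite -[in RHS](expn0 x); apply: xi_exp_eqmod.
by rewrite modnMl mod0n.
Qed.
End TeichmullerRoot.

(** * Identities for the star product of a brace *)

Section Braces.
Variables (A : finZmodType) (circ : A -> A -> A).
Hypothesis circB : is_brace circ.

Local Notation "x ** y" := (star circ x y) (at level 40, left associativity).

Lemma circE a b : circ a b = a + b + a ** b.
Proof. by rewrite /star -[circ a b - a - b]addrA -opprD addrC addNKr. Qed.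

Lemma circA a b c : circ a (circ b c) = circ (circ a b) c.
Proof. by case: circB => -[]. Qed.

Lemma starDr a b c : a ** (b + c) = a ** b + a ** c.
Proof.
case: circB => _ /(_ a b c) h.
apply: (addrI (a + (b + c) + a)); rewrite addrAC -circE h !circE.
by rewrite [LHS](AC (3*3) (1*(2*5)*4*(3*6))%AC).
Qed.

Lemma star0r a : a ** 0 = 0.
Proof. by apply: (addrI (a ** 0)); rewrite -starDr !addr0. Qed.

Lemma starNr a b : a ** (- b) = - (a ** b).
Proof. by apply: (addrI (a ** b)); rewrite -starDr !subrr star0r. Qed.

Lemma starMnr a b m : a ** (b *+ m) = a ** b *+ m.
Proof. by elim: m => [|m IH]; rewrite ?star0r // !mulrS starDr IH. Qed.

Lemma star_sumr a (I : Type) (r : seq I) (P : pred I) (E : I -> A) :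
  a ** (\sum_(i <- r | P i) E i) = \sum_(i <- r | P i) a ** E i.
Proof. exact: (big_morph _ (starDr a) (star0r a)). Qed.

Lemma brace_identity0 (e : A) : (forall a, circ e a = a /\ circ a e = a) -> e = 0.
Proof.
by move=> he; have := circE e 0; rewrite (he 0).1 star0r !addr0.
Qed.

Lemma circ0l a : circ 0 a = a.
Proof.
by case: circB => -[_ [e [he _]]] _; rewrite -(brace_identity0 he) (he a).1.
Qed.

Lemma star0l a : 0 ** a = 0.
Proof. by rewrite /star circ0l subr0 subrr. Qed.

(** Associativity of [circ] expanded by [circE]; equivalently, lam_(a o b) is lam_a after lam_b. *)
Lemma starA a b c : circ a b ** c = a ** c + b ** c + a ** (b ** c).
Proof.
have h : a + b + a ** b + c + circ a b ** c =
         a + (b + c + b ** c) + (a ** b + a ** c + a ** (b ** c)).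
  by rewrite -!starDr -(circE a b) -(circE (circ a b)) -(circE b c) -circE circA.
apply: (addrI (a + b + a ** b + c)); rewrite h.
by rewrite [RHS](AC (4*3) ((1*((2*4)*6))*((3*5)*7))%AC).
Qed.

Lemma circ_solve a x : exists w, circ a w = x.
Proof.
case: (circB) => -[_ [e [he hi]]] _; have [a' [haa' _]] := hi a.
by exists (circ a' x); rewrite circA haa' (he x).1.
Qed.

Definition ldiv a x : A := odflt 0 [pick w | circ a w == x].

Lemma circ_ldiv a x : circ a (ldiv a x) = x.
Proof.
rewrite /ldiv; case: pickP => [w /eqP // | h].
by have [w /eqP] := circ_solve a x; rewrite h.
Qed.

(* [A^{[max(1,i)]}]: the index 0 is allowed, so that constants have weight 0. *)
Definition filt (i : nat) (x : A) : Prop := bmem circ i.-1.+1 x.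

(** * The filtration of the brace by the subgroups A^[i] *)

Lemma bmem0 i : bmem circ i.+1 0.
Proof. by case: i => [|i]; [exact: bmem_one | apply: bmem_zero]. Qed.

Lemma bmemD i x y : bmem circ i.+1 x -> bmem circ i.+1 y -> bmem circ i.+1 (x + y).
Proof. by case: i => [|i] hx hy; [exact: bmem_one | apply: bmem_add]. Qed.

Lemma bmemN i x : bmem circ i.+1 x -> bmem circ i.+1 (- x).
Proof. by case: i => [|i] hx; [exact: bmem_one | apply: bmem_opp]. Qed.

(** A generator x * y is lowered through one factor: through y if x has weight 1, through x
    otherwise. Hence the strong induction on the weight around the induction on [bmem]. *)
Lemma bmem_decrS i x : bmem circ i.+2 x -> bmem circ i.+1 x.
Proof.
elim/ltn_ind: i x => i IHi x.
move En: i.+2 => m hx; elim: hx En => {m x}.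
- by [].
- move=> m j x y j0 jm hx _ hy _ mE; move: jm hy; rewrite -{m}mE => jm hy.
  case: i IHi jm hy => [|i] IHi jm hy; first exact: bmem_one.
  case: j j0 jm hx hy => [//|[|j]] _ jm hx hy.
    apply: (@bmem_gen _ _ _ 1) => //; rewrite subn1 /= in hy *.
    exact: IHi.
  apply: (@bmem_gen _ _ _ j.+1) => //.
    by apply: IHi => //; lia.
- by move=> m _ _; exact: bmem0.
- by move=> m x y _ _ IHx _ IHy mE; apply: bmemD; auto.
- by move=> m x _ _ IHx mE; apply: bmemN; auto.
Qed.

Lemma filt0 i : filt i 0. Proof. exact: bmem0. Qed.

Lemma filtD i x y : filt i x -> filt i y -> filt i (x + y).
Proof. exact: bmemD. Qed.

Lemma filtN i x : filt i x -> filt i (- x).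
Proof. exact: bmemN. Qed.

Lemma filtMn i x m : filt i x -> filt i (x *+ m).
Proof.
by move=> hx; elim: m => [|m IH]; [exact: filt0 | rewrite mulrS; apply: filtD].
Qed.

Lemma filt1 x : filt 1 x. Proof. exact: bmem_one. Qed.

Lemma filt_le i j x : (i <= j)%N -> filt j x -> filt i x.
Proof.
rewrite /filt => ij; have : (i.-1 <= j.-1)%N by lia.
elim: j.-1 => [|m IH]; first by rewrite leqn0 => /eqP ->.
by rewrite leq_eqVlt => /predU1P[-> //|lt] /bmem_decrS; apply: IH; lia.
Qed.

Lemma filt_star i j x y : filt i x -> filt j y -> filt (i + j) (x ** y).
Proof.
move=> hx hy; apply: (@filt_le _ (i.-1.+1 + j.-1.+1)); first by lia.
rewrite /filt addnS /=; apply: (@bmem_gen _ _ _ i.-1.+1) => //; first by lia.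
by rewrite (_ : (_ - _ = j.-1.+1)%N) //; lia.
Qed.

Lemma filt_iter i l j a x : filt i a -> filt l x ->
  filt (i * j + l) (iter j (star circ a) x).
Proof.
move=> ha hx; elim: j => [|j IH] /=; first by rewrite muln0.
by rewrite mulnS -addnA; apply: filt_star.
Qed.

(** * Powers in (A, o) and the binomial theorem *)

Definition cpow (a : A) (m : nat) : A := iter m (circ a) 0.

Lemma cpowD a m m' : cpow a (m + m') = circ (cpow a m) (cpow a m').
Proof.
elim: m => [|m IH]; first by rewrite circ0l.
by rewrite addSn /cpow !iterS -!/(cpow _ _) IH circA.
Qed.

Section Nilpotent.
Variable k : nat.
Hypothesis k1 : (1 < k)%N.
Hypothesis filt_k : forall x, filt k x -> x = 0.

Lemma filt_ge i x : (k <= i)%N -> filt i x -> x = 0.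
Proof. by move=> ki /(filt_le ki)/filt_k. Qed.

Lemma iter_star_ge j a x : (k <= j.+1)%N -> iter j (star circ a) x = 0.
Proof.
move=> kj; apply: (@filt_ge (1 * j + 1)); first by lia.
by apply: filt_iter; apply: filt1.
Qed.

(** This expands the m-th power of lam_a = 1 + [star circ a]. In Pascal's rule the top term carries
    k factors [star circ a] and vanishes. *)
Lemma lam_cpow a m b :
  b + cpow a m ** b = \sum_(j < k) iter j (star circ a) b *+ 'C(m, j).
Proof.
case: k k1 iter_star_ge => // k' _ nil.
elim: m => [|m IH].
  rewrite star0l addr0 big_ord_recl big1 ?addr0 //.
rewrite (_ : cpow a m.+1 = circ a (cpow a m)) // starA.
have -> : b + (a ** b + cpow a m ** b + a ** (cpow a m ** b)) =
    (b + cpow a m ** b) + a ** (b + cpow a m ** b).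
  by rewrite starDr [LHS](AC (1*3) ((1*3)*(2*4))%AC).
rewrite IH star_sumr big_ord_recl [in RHS]big_ord_recl /= !bin0 -addrA.
congr (_ + _); under [RHS]eq_bigr do rewrite /bump /= add1n binS mulrnDr.
rewrite [RHS]big_split /=; congr (_ + _).
rewrite big_ord_recr /= starMnr -iterS nil ?mul0rn ?addr0 //.
by apply: eq_bigr => i _; rewrite starMnr.
Qed.

Lemma star_cpow a m b :
  cpow a m ** b = \sum_(1 <= j < k) iter j (star circ a) b *+ 'C(m, j).
Proof.
apply: (addrI b); rewrite lam_cpow.
rewrite -(big_mkord xpredT (fun j => iter j (star circ a) b *+ 'C(m, j))).
by rewrite big_ltn ?bin0 //; lia.
Qed.

(** The same induction, from a^(m+1) = a + a^m + a * a^m. *)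
Lemma cpow_sum a m :
  cpow a m = \sum_(1 <= j < k) iter j.-1 (star circ a) a *+ 'C(m, j).
Proof.
have nil := @iter_star_ge k.-1 a; rewrite big_add1.
elim: m => [|m IH]; first by rewrite big1 // => j _; rewrite bin0n.
rewrite (_ : cpow a m.+1 = a + (cpow a m + a ** cpow a m)); last first.
  by rewrite addrA -circE.
under [RHS]eq_bigr do rewrite binS mulrnDr.
rewrite big_split /= {1}IH addrCA; congr (_ + _).
have [k' kE] : exists k', k.-1 = k'.+1 by exists k.-2; lia.
rewrite kE in nil IH *.
rewrite IH star_sumr big_nat_recr // [RHS]big_nat_recl //= bin0; congr (_ + _).
rewrite starMnr -iterS nil ?mul0rn ?addr0; last by lia.
by apply: eq_bigr => j _; rewrite starMnr.
Qed.

(** * Division modulo p^n, and polynomial functions of m with filtered coefficients *)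

Variables p n : nat.
Hypothesis p_pr : prime p.
Hypothesis cardA : #|A| = (p ^ n)%N.
Hypothesis k_lt_p : (k < p)%N.

Lemma mulrn_eqmod (x : A) m m' : m = m' %[mod p ^ n] -> x *+ m = x *+ m'.
Proof.
have x0 : x *+ p ^ n = 0.
  by rewrite -cardA -cardsT -FinRing.zmodXgE expg_cardG ?inE.
move=> h; rewrite (divn_eq m (p ^ n)) (divn_eq m' (p ^ n)) h.
by rewrite !mulrnDr ![(_ %/ _ * _)%N]mulnC !mulrnA x0 !mul0rn.
Qed.

Lemma coprime_lt_prime j : (0 < j < p)%N -> coprime j (p ^ n).
Proof.
case/andP=> j0 jp; rewrite coprime_sym coprimeXl // prime_coprime //.
by apply/negP => /(dvdn_leq j0); rewrite leqNgt jp.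
Qed.

Lemma divAK d (x : A) : coprime d (p ^ n) -> divA d (x *+ d) = x.
Proof.
move=> cop; rewrite /divA -mulrnA -expnS prednK; last first.
  by rewrite totient_gt0 cardA expn_gt0 prime_gt0.
by rewrite -[RHS]mulr1n; apply: mulrn_eqmod; rewrite cardA Euler_exp_totient.
Qed.

(* The bound [j < k] loses nothing, as [c j] lies in [filt k], which is zero,
   for [k <= j]. *)
Definition polyfun (i d : nat) (u : nat -> A) : Prop :=
  exists c : nat -> A, [/\ forall j, filt (maxn i j) (c j),
    forall j, (j < d)%N -> c j = 0 &
    forall m, u m = \sum_(j < k) c j *+ m ^ j].

Lemma eq_polyfun i d u v : (forall m, u m = v m) -> polyfun i d v -> polyfun i d u.
Proof. by move=> uv [c [c1 c2 c3]]; exists c; split=> // m; rewrite uv. Qed.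

Lemma polyfun0 i d : polyfun i d (fun=> 0).
Proof.
exists (fun=> 0); split=> // [j|m]; first exact: filt0.
by rewrite big1 // => j _; rewrite mul0rn.
Qed.

Lemma polyfunD i d u v : polyfun i d u -> polyfun i d v ->
  polyfun i d (fun m => u m + v m).
Proof.
move=> [b [b1 b2 b3]] [c [c1 c2 c3]]; exists (fun j => b j + c j).
split=> [j|j jd|m]; first exact: filtD.
  by rewrite b2 ?c2 ?addr0.
by rewrite b3 c3 -big_split; apply: eq_bigr => j _; rewrite mulrnDl.
Qed.

Lemma polyfunN i d u : polyfun i d u -> polyfun i d (fun m => - u m).
Proof.
move=> [b [b1 b2 b3]]; exists (fun j => - b j).
split=> [j|j jd|m]; first exact: filtN.
  by rewrite b2 ?oppr0.
by rewrite b3 -sumrN; apply: eq_bigr => j _; rewrite mulNrn.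
Qed.

Lemma polyfunMn i d u e : polyfun i d u -> polyfun i d (fun m => u m *+ e).
Proof.
move=> hu; elim: e => [|e IH]; first exact: polyfun0.
by apply: eq_polyfun (polyfunD hu IH) => m; rewrite mulrS.
Qed.

Lemma polyfun_sum i d (I : eqType) (r : seq I) (E : I -> nat -> A) :
  (forall t, t \in r -> polyfun i d (E t)) ->
  polyfun i d (fun m => \sum_(t <- r) E t m).
Proof.
elim: r => [|t r IH] hE.
  by apply: eq_polyfun (polyfun0 i d) => m; rewrite big_nil.
have ht : polyfun i d (E t) by apply: hE; rewrite mem_head.
apply: eq_polyfun (polyfunD ht (IH _)) => [m|t' rt']; first by rewrite big_cons.
by apply: hE; rewrite in_cons rt' orbT.
Qed.

Lemma polyfun_le i d i' d' u : (i' <= i)%N -> (d' <= d)%N ->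
  polyfun i d u -> polyfun i' d' u.
Proof.
move=> ii dd [c [c1 c2 c3]]; exists c; split=> // [j|j jd].
  by apply: filt_le (c1 j); lia.
by apply: c2; lia.
Qed.

Lemma polyfun_monom i d j a : filt (maxn i j) a -> (d <= j)%N ->
  polyfun i d (fun m => a *+ m ^ j).
Proof.
move=> ha dj; exists (fun l => if l == j then a else 0).
split=> [l|l ld|m]; first by case: eqP => [->|_] //; exact: filt0.
  by case: eqP => // lj; lia.
rewrite (eq_bigr (fun l : 'I_k => if l == j :> nat then a *+ m ^ j else 0));
  last first.
  by move=> l _; case: eqP => [->|_] //; rewrite mul0rn.
rewrite -big_mkcond /= (big_ord1_eq _ (fun=> a *+ m ^ j)).
by case: ltnP => // kj; rewrite (@filt_ge (maxn i j) a) ?mul0rn //; lia.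
Qed.

Lemma polyfun_split i d u : polyfun i d u -> exists a z,
  [/\ filt (maxn i d) a, polyfun i d.+1 z & forall m, u m = a *+ m ^ d + z m].
Proof.
move=> [c [c1 c2 c3]]; exists (c d), (fun m => u m - c d *+ m ^ d).
split=> // [|m]; last by rewrite addrC subrK.
exists (fun j => if j == d then 0 else c j); split=> [j|j|m].
- by case: eqP => // _; exact: filt0.
- by rewrite ltnS leq_eqVlt; case: eqP => //= _; exact: c2.
have -> : c d *+ m ^ d = \sum_(j < k) (if j == d :> nat then c j *+ m ^ j else 0).
  rewrite -big_mkcond /= (big_ord1_eq _ (fun j => c j *+ m ^ j)).
  (* For d >= k the term in degree d is missing from the sum, but then [c d] is zero by weight. *)
  by case: ltnP => // kd; rewrite (@filt_ge (maxn i d) (c d)) ?mul0rn //; lia.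
rewrite c3 -sumrB; apply: eq_bigr => j _.
by case: eqP => _; rewrite ?subrr ?mul0rn ?subr0.
Qed.

(** Induction by (j+1) C(s, j+1) = s C(s, j) - j C(s, j) at s = m^d, where j+1 < p can be inverted.
    The factor m^l absorbs the multiplication by s; the weight of [b] matches the top degree dj +
    l. *)
Lemma polyfun_bin i d j l b : (0 < j < p)%N -> filt (maxn i (d * j + l)) b ->
  polyfun i (d + l) (fun m => b *+ ('C(m ^ d, j) * m ^ l)).
Proof.
elim: j l b => [//|j IH] l b /andP[_ jp] hb.
have [j0|j0] := posnP j.
  rewrite j0 muln1 in hb *; apply: eq_polyfun (polyfun_monom hb (leqnn _)) => m.
  by rewrite bin1 expnD.
have jp' : (0 < j < p)%N by lia.
have h1 : polyfun i (d + l) (fun m => b *+ ('C(m ^ d, j) * m ^ (d + l))).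
  have := IH (d + l)%N b jp'; rewrite addnA -mulnSr => /(_ hb).
  by apply: polyfun_le => //; lia.
have h2 : polyfun i (d + l) (fun m => (b *+ j) *+ ('C(m ^ d, j) * m ^ l)).
  by apply: IH => //; apply: filtMn; apply: filt_le hb; lia.
apply: eq_polyfun (polyfunMn (j.+1 ^ (totient #|A|).-1) (polyfunD h1 (polyfunN h2))).
move=> m; rewrite -/(divA j.+1 _) -[LHS](@divAK j.+1); last first.
  by apply: coprime_lt_prime; lia.
congr divA; apply/eqP; rewrite eq_sym subr_eq -!mulrnA -mulrnDr.
apply/eqP; congr (_ *+ _).
have := mul_bin_left (m ^ d) j; rewrite expnD.
(* The subtraction in [mul_bin_left] is truncated; below j both binomials vanish. *)
case: (leqP j (m ^ d)) => [|lt]; last by rewrite !bin_small //; lia.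
move: (m ^ d)%N (m ^ l)%N => s t; move: 'C(s, j.+1) 'C(s, j) => b1 b2 js h.
have {}h : (s * b2 = j.+1 * b1 + j * b2)%N
  by rewrite h mulnBl subnK // leq_mul2r js orbT.
by rewrite mulnA [(b2 * s)%N]mulnC h; lia.
Qed.

(** * Left star multiplication by polynomial functions *)

Definition graded_left (d : nat) (x : nat -> A) : Prop :=
  forall i e v, polyfun i e v -> polyfun i (d + e) (fun m => x m ** v m).

Lemma graded_left_le d d' x : (d' <= d)%N -> graded_left d x -> graded_left d' x.
Proof. by move=> dd hx i e v /hx; apply: polyfun_le => //; lia. Qed.

(** This replaces additivity in the left factor, which the star product lacks: left factors are
    combined by [circ], through [starA]. *)
Lemma graded_left_circ d x w u : (forall m, u m = circ (x m) (w m)) ->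
  graded_left d x -> graded_left d w -> graded_left d u.
Proof.
move=> uE hx hw i e v hv.
have h : polyfun i (d + e) (fun m => x m ** (w m ** v m)).
  by apply: polyfun_le (hx _ _ _ (hw _ _ _ hv)) => //; lia.
apply: eq_polyfun (polyfunD (polyfunD (hx _ _ _ hv) (hw _ _ _ hv)) h) => m.
by rewrite uE starA.
Qed.

(** By [star_cpow], each degree d in m gained from C(m^d, j) is paid for by one more factor
    [star circ a], of weight d. *)
Lemma graded_left_cpow d a : filt d a -> graded_left d (fun m => cpow a (m ^ d)).
Proof.
move=> ha i e v [c [c1 c2 c3]].
pose E (l j : nat) m := iter j (star circ a) (c l) *+ ('C(m ^ d, j) * m ^ l).
apply: (@eq_polyfun _ _ _
  (fun m => \sum_(l <- enum 'I_k) \sum_(j <- index_iota 1 k) E l j m)) => [m|].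
  rewrite c3 star_sumr big_enum /=; apply: eq_bigr => l _.
  rewrite starMnr star_cpow -sumrMnl; apply: eq_bigr => j _.
  by rewrite /E mulrnA.
apply: polyfun_sum => l _; apply: polyfun_sum => j; rewrite mem_index_iota => hj.
have [le|el] := ltnP l e.
  apply: eq_polyfun (polyfun0 _ _) => m.
  rewrite /E c2 // (_ : iter _ _ 0 = 0) ?mul0rn //.
  by elim: j {hj} => //= j ->; rewrite star0r.
apply: (@polyfun_le i (d + l)); rewrite ?leq_add2l //.
apply: polyfun_bin; first by lia.
by apply: filt_le (filt_iter j ha (c1 l)); lia.
Qed.

(* [w = lam_x^-1 y] is the finite geometric series
   [y - x ** y + x ** (x ** y) - ...]. *)
Lemma polyfun_lam_inv d x w y i e : graded_left d x -> polyfun i e y ->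
  (forall m, circ (x m) (w m) = x m + y m) -> polyfun i e w.
Proof.
move=> hx hy hw.
have wE m : w m = y m - x m ** w m.
  by apply: (addrI (x m)); rewrite addrA -hw circE addrK.
pose t s m := iter s (fun z => y m - x m ** z) 0.
have ht s : polyfun i e (t s).
  elim: s => [|s IH]; first exact: polyfun0.
  apply: polyfunD hy (polyfunN _).
  by apply: polyfun_le (hx _ _ _ IH) => //; lia.
(* The partial sum [t s] agrees with [w] modulo A^[s+1], so [t k] equals [w]. *)
have hf s m : filt s.+1 (w m - t s m).
  elim: s => [|s IH]; first exact: filt1.
  have -> : w m - t s.+1 m = x m ** (- (w m - t s m)).
    rewrite [in RHS]opprB starDr starNr {1}wE /t iterS -/(t s m).
    by rewrite [- (y m - _)]opprB [LHS]addrC addrA addrNK.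
  by rewrite -[s.+2]add1n; apply: filt_star; [exact: filt1 | exact: filtN].
apply: eq_polyfun (ht k) => m.
by apply/eqP; rewrite -subr_eq0; apply/eqP/(@filt_ge k.+1).
Qed.

(* Downward induction on [i + d]: writing [u m = a *+ m ^ d + z m], the first
   summand differs from the power [cpow a (m ^ d)], for which the claim is the
   binomial theorem, by a function of larger [i], and [z] has larger [d]. *)
Lemma polyfun_graded_left i d u : (0 < i)%N -> polyfun i d u -> graded_left d u.
Proof.
(* [N] bounds 2k - (i + d). At N = 0, i or d is at least k, so every coefficient vanishes, by weight
   or by degree. *)
suff H N : forall i d u, (0 < i)%N -> (2 * k <= i + d + N)%N ->
    polyfun i d u -> graded_left d u.
  by move=> i0; apply: (H (2 * k)%N) => //; lia.
elim: N => [|N IH] {}i {}d {}u i0 hN hu.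
  have u0 m : u m = 0.
    case: hu => c [c1 c2 ->]; rewrite big1 // => j _.
    have [/c2 ->|dj] := ltnP j d; first by rewrite mul0rn.
    by rewrite (filt_ge _ (c1 j)) ?mul0rn //; lia.
  by move=> i' e v _; apply: eq_polyfun (polyfun0 _ _) => m; rewrite u0 star0l.
have [a [z [ha hz uE]]] := polyfun_split hu.
pose x m := cpow a (m ^ d).
have gx : graded_left d x by apply: graded_left_cpow; apply: filt_le ha; lia.
(* The term j = 1 of [cpow_sum] cancels [a *+ m ^ d]. For j >= 2 the weight j max(i, d) is at least
   max(i+1, dj), because i > 0. *)
have hr : polyfun i.+1 d (fun m => a *+ m ^ d - x m).
  pose E (j : nat) m := iter j.-1 (star circ a) a *+ ('C(m ^ d, j) * m ^ 0).
  apply: (@eq_polyfun _ _ _ (fun m => - \sum_(j <- index_iota 2 k) E j m)) => [m|].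
    rewrite /x cpow_sum big_ltn //= bin1 opprD addNKr; congr (- _).
    by apply: eq_bigr => j _; rewrite /E muln1.
  apply: polyfunN; apply: polyfun_sum => j; rewrite mem_index_iota => hj.
  rewrite -[d]addn0; apply: polyfun_bin; first by lia.
  apply: filt_le (filt_iter j.-1 ha ha); rewrite addn0 -mulnSr.
  by rewrite prednK; nia.
(* Here [a *+ m ^ d] is x o w, where w is the image of the difference in [hr] under the inverse of
   lam_x, so i has grown. *)
have ga : graded_left d (fun m => a *+ m ^ d).
  pose w m := ldiv (x m) (a *+ m ^ d).
  have hw : polyfun i.+1 d w.
    by apply: (polyfun_lam_inv gx hr) => m; rewrite circ_ldiv addrC subrK.
  apply: (@graded_left_circ _ x w) => // [m|]; first by rewrite circ_ldiv.
  by apply: IH hw => //; lia.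
pose w m := ldiv (a *+ m ^ d) (u m).
have hw : polyfun i d.+1 w.
  by apply: (polyfun_lam_inv ga hz) => m; rewrite circ_ldiv uE.
apply: (@graded_left_circ _ _ w) ga _ => [m|]; first by rewrite circ_ldiv.
by apply: graded_left_le (leqnSn d) _; apply: IH hw => //; lia.
Qed.

Lemma polyfun_star i d e u v : (0 < i)%N -> polyfun i d u -> polyfun i e v ->
  polyfun i (d + e) (fun m => u m ** v m).
Proof. by move=> i0 /(polyfun_graded_left i0) h /h. Qed.

Lemma polyfun_cpow g : polyfun 1 1 (cpow g).
Proof.
pose E (j : nat) m := iter j.-1 (star circ g) g *+ ('C(m ^ 1, j) * m ^ 0).
apply: (@eq_polyfun _ _ _ (fun m => \sum_(j <- index_iota 1 k) E j m)) => [m|].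
  by rewrite cpow_sum; apply: eq_bigr => j _; rewrite /E expn1 muln1.
apply: polyfun_sum => j; rewrite mem_index_iota => hj.
rewrite -[X in polyfun _ X]addn0; apply: polyfun_bin; first by lia.
by apply: filt_le (filt_iter j.-1 (filt1 g) (filt1 g)); lia.
Qed.

(** * The operators lam_(g^m) as functions of m *)

Definition lam_pow g m x : A := x + cpow g m ** x.

Lemma lam_pow_sum g m (I : Type) (r : seq I) (P : pred I) (E : I -> A) :
  lam_pow g m (\sum_(i <- r | P i) E i) = \sum_(i <- r | P i) lam_pow g m (E i).
Proof.
apply: (big_morph (lam_pow g m)) => [x y|]; last by rewrite /lam_pow star0r addr0.
by rewrite /lam_pow starDr addrACA.
Qed.

Lemma lam_powMn g m x e : lam_pow g m (x *+ e) = lam_pow g m x *+ e.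
Proof. by rewrite /lam_pow mulrnDl -starMnr. Qed.

Lemma lam_powD g m m' x : lam_pow g (m + m') x = lam_pow g m (lam_pow g m' x).
Proof.
rewrite /lam_pow cpowD starA starDr.
by rewrite [LHS](AC (1*3) ((1*3)*(2*4))%AC).
Qed.

Lemma cpow1 g : cpow g 1 = g.
Proof. by rewrite [LHS]circE star0r !addr0. Qed.

Lemma circ_lam_pow g x : circ g x = g + lam_pow g 1 x.
Proof. by rewrite /lam_pow cpow1 addrA -circE. Qed.

Lemma polyfun_const x : polyfun 1 0 (fun=> x).
Proof.
apply: (eq_polyfun (v := fun m => x *+ m ^ 0)) => [m|]; first by rewrite mulr1n.
by apply: polyfun_monom => //; apply: filt1.
Qed.

Lemma polyfun_lam_pow g x : polyfun 1 0 (fun m => lam_pow g m x).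
Proof.
apply: polyfunD; first exact: polyfun_const.
apply: (@polyfun_le 1 1) => //.
exact: (@polyfun_star 1 1 0 _ _ isT (polyfun_cpow g) (polyfun_const x)).
Qed.

(** * Extraction of coefficients by roots of unity *)

Variable gamma : nat.
Hypothesis gammaP : primitive_root_mod (p ^ p) gamma.
Hypothesis n_lt_p : (n < p)%N.

(* The factor [1 + p + ... + p^(n-1)] is minus the inverse of [p-1] modulo [p^n]. *)
Definition coef (l : nat) (u : nat -> A) : A :=
  - ((\sum_(i < p.-1) u (xi p gamma ^ i)%N *+ xi p gamma ^ (l * (p.-1 - i)))
      *+ (\sum_(i < n) p ^ i)).

(** By [sum_xi] the sum leaves (p-1) c_l, and -(p-1)(1 + p + ... + p^(n-1)) = 1 - p^n acts as 1 on
    A. *)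
Lemma coefE (c : nat -> A) u l :
  (forall m, u m = \sum_(j < k) c j *+ m ^ j) -> (l < k)%N ->
  coef l u = c l.
Proof.
move=> uE lk.
have -> : coef l u = - ((\sum_(j < k) (if j == l :> nat then c j *+ p.-1 else 0))
    *+ (\sum_(i < n) p ^ i)).
  rewrite /coef; congr (- (_ *+ _)).
  under eq_bigr do rewrite uE -sumrMnl.
  rewrite exchange_big /=; apply: eq_bigr => j _.
  under eq_bigr do rewrite -!mulrnA -expnM.
  rewrite sumrMnr (mulrn_eqmod _ (sum_xi p_pr gammaP n_lt_p _ _)); try by lia.
    by case: eqP => _; rewrite ?mul1n ?mul0n.
  by have := ltn_ord j; lia.
rewrite -big_mkcond /= (big_ord1_eq _ (fun j => c j *+ p.-1)) lk.
rewrite -mulrnA -predn_exp; apply/eqP; rewrite eq_sym -addr_eq0 -mulrS.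
by rewrite prednK ?expn_gt0 ?prime_gt0 // (@mulrn_eqmod _ _ 0) // modnn mod0n.
Qed.

Lemma coef_uniq (c c' : nat -> A) l :
  (forall m, \sum_(j < k) c j *+ m ^ j = \sum_(j < k) c' j *+ m ^ j) ->
  (l < k)%N -> c l = c' l.
Proof.
move=> cc' lk; rewrite -(coefE (fun=> erefl) lk).
by apply: coefE lk => m; rewrite cc'.
Qed.

Lemma odotE a b : odot circ p n gamma a b = coef 1 (fun m => (a *+ m) ** b).
Proof. by rewrite /odot /dot /coef; under [in RHS]eq_bigr do rewrite mul1n. Qed.

Lemma odot0r a : odot circ p n gamma a 0 = 0.
Proof.
by rewrite odotE /coef big1 ?mul0rn ?oppr0 // => i _; rewrite star0r mul0rn.
Qed.

Lemma coefD l u v : coef l (fun m => u m + v m) = coef l u + coef l v.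
Proof.
rewrite /coef -opprD -mulrnDl -big_split /=; congr (- (_ *+ _)).
by apply: eq_bigr => i _; rewrite mulrnDl.
Qed.

Lemma eq_coef l u v : (forall m, u m = v m) -> coef l u = coef l v.
Proof. by move=> uv; congr (- (_ *+ _)); apply: eq_bigr => i _; rewrite uv. Qed.

Lemma coef_polyfun i d l u : polyfun i d u -> (l < d)%N -> (l < k)%N -> coef l u = 0.
Proof. by move=> [c [_ c2 c3]] ld lk; rewrite (coefE c3 lk) c2. Qed.

Lemma polyfun_coef i d u m : polyfun i d u -> u m = \sum_(j < k) coef j u *+ m ^ j.
Proof.
move=> [c [_ _ c3]]; rewrite {1}c3.
by apply: eq_bigr => j _; rewrite (coefE c3) ?ltn_ord.
Qed.

Lemma coef1_const x : coef 1 (fun=> x) = 0.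
Proof.
rewrite (@coefE (fun j => if j == 0%N then x else 0)) // => m.
case: k k1 => // k' _; rewrite big_ord_recl big1 ?addr0 ?mulr1n // => i _.
by rewrite mul0rn.
Qed.

(* Chain rule: the terms of [cpow g m] of degree at least 2 in [m] contribute
   only such terms to [cpow g m ** x]. *)
Lemma coef1_lam_pow g x :
  coef 1 (fun m => lam_pow g m x) = odot circ p n gamma (coef 1 (cpow g)) x.
Proof.
have [c [z [hc hz gE]]] := polyfun_split (polyfun_cpow g).
have h1 : polyfun 1 1 (fun m => c *+ m).
  apply: (eq_polyfun (v := fun m => c *+ m ^ 1)) => [m|]; first by rewrite expn1.
  exact: polyfun_monom.
have gl : graded_left 1 (fun m => c *+ m) by apply: polyfun_graded_left h1.
have cE : coef 1 (cpow g) = c.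
  rewrite (eq_coef _ gE) coefD (coef_polyfun hz) // addr0.
  rewrite (@coefE (fun j => if j == 1%N then c else 0)) // => m.
  rewrite (eq_bigr (fun j : 'I_k => if j == 1%N :> nat then c *+ m ^ 1 else 0)).
    by rewrite -big_mkcond /= (big_ord1_eq _ (fun=> c *+ m ^ 1)) k1.
  by move=> j _; case: eqP => [->|_]; rewrite ?mul0rn.
(* Now g^m = (cm) o w with w of order at least 2 in m, so by [starA] only (cm) * x reaches degree
   1. *)
pose w m := ldiv (c *+ m) (cpow g m).
have hw : polyfun 1 2 w.
  by apply: (polyfun_lam_inv gl hz) => m; rewrite circ_ldiv gE expn1.
have hwx : polyfun 1 2 (fun m => w m ** x).
  exact: (@polyfun_star 1 2 0 _ _ isT hw (polyfun_const x)).
have hcwx : polyfun 1 2 (fun m => (c *+ m) ** (w m ** x)).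
  by apply: (@polyfun_le 1 3) => //; exact: (@polyfun_star 1 1 2 _ _ isT h1 hwx).
rewrite cE odotE (@eq_coef _ _ (fun m =>
  x + ((c *+ m) ** x + w m ** x + (c *+ m) ** (w m ** x)))) => [|m].
  rewrite 3!coefD coef1_const add0r (coef_polyfun hwx) //.
  by rewrite (coef_polyfun hcwx) // !addr0.
by rewrite -starA circ_ldiv.
Qed.

(** Comparing the coefficients of m in f(m' + m) gives the formal derivative f'(m') =
    lam_(g^m')(c_1), whose coefficients are then compared. As j+1 reaches k, [c k] must be zero. *)
Lemma shift_coef g (c e alpha f : nat -> A) :
  (forall m, f m = \sum_(j < k) c j *+ m ^ j) ->
  (forall m m', f (m' + m)%N = alpha m' + lam_pow g m' (f m)) ->
  (forall m, lam_pow g m (c 1%N) = \sum_(j < k) e j *+ m ^ j) ->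
  c k = 0 -> forall l, (l < k)%N -> c l.+1 *+ l.+1 = e l.
Proof.
move=> fE fD eE ck l lk.
apply: (@coef_uniq (fun j => c j.+1 *+ j.+1)) lk => m'.
rewrite -eE.
(* For fixed m', [b] and [b'] are the coefficients of f(m' + m) in m, from the binomial formula and
   from the functional equation. *)
pose b j := \sum_(i < k) c i *+ ('C(i, j) * m' ^ (i - j)).
pose b' j := lam_pow g m' (c j) + (if j == 0%N then alpha m' else 0).
have -> : lam_pow g m' (c 1%N) = b' 1%N by rewrite /b' addr0.
rewrite -(@coef_uniq b b' 1%N) // => [|m].
  case: k ck @b => [|k'] ck b; first by rewrite /b !big_ord0.
  rewrite big_ord_recr /= ck mul0rn mul0rn addr0 /b big_ord_recl /=.
  rewrite bin0n mul0n mulr0n add0r.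
  apply: eq_bigr => j _; rewrite /bump /= add1n bin1 subSS subn0.
  by rewrite mulrnA.
transitivity (f (m' + m)%N).
  rewrite fE; under eq_bigr do rewrite /b -sumrMnl.
  rewrite exchange_big /=; apply: eq_bigr => i _.
  rewrite expnDn (big_ord_widen k (fun j => 'C(i, j) * (m' ^ (i - j) * m ^ j))%N) //.
  rewrite [in RHS]big_mkcond /= -sumrMnr; apply: eq_bigr => j _.
  rewrite -mulrnA -mulnA.
  by case: ltnP => // ij; rewrite bin_small.
rewrite fD fE lam_pow_sum; under [RHS]eq_bigr do rewrite /b' mulrnDl.
rewrite [RHS]big_split [LHS]addrC /=; congr (_ + _).
  by apply: eq_bigr => j _; rewrite lam_powMn.
rewrite (eq_bigr (fun j : 'I_k => if j == 0%N :> nat then alpha m' else 0)).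
  by rewrite -big_mkcond /= (big_ord1_eq _ (fun=> alpha m')) ltnW.
by move=> j _; case: eqP => [->|_]; rewrite ?mul0rn.
Qed.

(** * The exponential formula and the group of flows *)

Definition lam_coef g (l : nat) x : A :=
  if (l < k)%N then coef l (fun m => lam_pow g m x) else 0.

Lemma lam_powE g m x : lam_pow g m x = \sum_(j < k) lam_coef g j x *+ m ^ j.
Proof.
rewrite (polyfun_coef m (polyfun_lam_pow g x)).
by apply: eq_bigr => j _; rewrite /lam_coef ltn_ord.
Qed.

Local Notation D g := (odot circ p n gamma (coef 1 (cpow g))).

(** The differential equation of lam_(g^m): its derivative in m is lam_(g^m) after [D g]. *)
Lemma lam_coefS g l x : lam_coef g l.+1 x *+ l.+1 = lam_coef g l (D g x).
Proof.
have [kl|lk] := leqP k l; first by rewrite /lam_coef !ltnNge kl (leqW kl) mul0rn.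
apply: (@shift_coef g (lam_coef g ^~ x) (lam_coef g ^~ (D g x)) (fun=> 0)
  (fun m => lam_pow g m x)) lk => [m|m m'|m|].
- exact: lam_powE.
- by rewrite add0r lam_powD.
- by rewrite /lam_coef k1 coef1_lam_pow -lam_powE.
- by rewrite /lam_coef ltnn.
Qed.

Lemma lam_coef0 g x : lam_coef g 0 x = x.
Proof.
have := lam_powE g 0 x; rewrite {1}/lam_pow star0l addr0 => {2}->.
case: k k1 => // k' _; rewrite big_ord_recl big1 ?addr0 ?mulr1n // => i _.
by rewrite exp0n.
Qed.

(** Descending to degree 0, where lam is the identity, gives lam_(g^m) = e^(m D). *)
Lemma lam_coef_iter g l x : lam_coef g l x *+ l`! = iter l (D g) x.
Proof.
elim: l x => [|l IH] x; first exact: lam_coef0.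
by rewrite factS mulrnA lam_coefS IH -iterSr.
Qed.

Lemma divA_fact j (x : A) : (j < p)%N -> divA j`! (x *+ j`!) = x.
Proof.
move=> jp; apply: divAK; elim: j jp => [|j IH] jp; first by rewrite coprime1n.
by rewrite factS coprimeMl IH ?andbT ?coprime_lt_prime //; lia.
Qed.

Lemma circ_expL g b : circ g b = g + expL circ p n gamma (coef 1 (cpow g)) b.
Proof.
rewrite circ_lam_pow lam_powE; congr (_ + _).
have iE j : iter j (L_id circ p n gamma (coef 1 (cpow g))) (b, 0) =
    (iter j (D g) b, 0).
  by elim: j => //= j ->; rewrite /L_id /mul_id /= !mulr0z !addr0 mulr0.
rewrite /expL /exp_id /= (eq_big_nat _ _ (F2 := fun j => lam_coef g j b)); last first.
  by move=> j /andP[_ jp]; rewrite iE /= -lam_coef_iter divA_fact.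
rewrite -[X in X + _](lam_coef0 g) -big_ltn ?prime_gt0 // big_mkord.
(* The sum may run up to p, since [lam_coef] is zero from k on. *)
rewrite (big_ord_widen p (fun j => lam_coef g j b *+ 1 ^ j)) 1?ltnW // big_mkcond /=.
by apply: eq_bigr => j _; rewrite exp1n; case: ifP => // jk; rewrite /lam_coef jk.
Qed.

(** The derivative of g^m in m is e^(m D)(c), so g^m is the sum of D^l(c) m^(l+1) / (l+1)!; at m = 1
    this is W(c). *)
Lemma W_coef_cpow g : W circ p n gamma (coef 1 (cpow g)) = g.
Proof.
set c := coef 1 (cpow g).
pose a l := if (l < k)%N then coef l (cpow g) else 0.
have aE m : cpow g m = \sum_(j < k) a j *+ m ^ j.
  rewrite (polyfun_coef m (polyfun_cpow g)).
  by apply: eq_bigr => j _; rewrite /a ltn_ord.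
have a0 : a 0%N = 0.
  by rewrite /a ltnW // (coef_polyfun (polyfun_cpow g)) // ltnW.
have aS l : a l.+1 *+ l.+1`! = iter l (D g) c.
  have [kl|lk] := leqP k l.
    by rewrite -lam_coef_iter /a /lam_coef !ltnNge kl (leqW kl) !mul0rn.
  rewrite factS mulrnA (@shift_coef g a (lam_coef g ^~ c) (cpow g) (cpow g)) //.
  - exact: lam_coef_iter.
  - by move=> m m'; rewrite cpowD /lam_pow addrA -circE.
  - by move=> m; rewrite /a k1 lam_powE.
  - by rewrite /a ltnn.
(* L_c sends 1 to c, which shifts the powers of D by one. *)
have iE j : iter j.+1 (L_id circ p n gamma c) (0, 1) = (iter j (D g) c, 0).
  elim: j => [|j IH]; last first.
    by rewrite iterS IH /L_id /mul_id /= !mulr0z !addr0 mulr0.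
  by rewrite /L_id /mul_id /= odot0r mul0rz mulr1z addr0 add0r mul0r.
rewrite /W /exp_id /= add0r (eq_big_nat _ _ (F2 := a)); last first.
  by case=> // j /andP[_ jp]; rewrite iE /= -aS divA_fact.
rewrite -[RHS]cpow1 aE -[LHS]add0r -[X in X + _]a0 -big_ltn ?prime_gt0 // big_mkord.
rewrite (big_ord_widen p (fun j => a j *+ 1 ^ j)) 1?ltnW // [RHS]big_mkcond /=.
by apply: eq_bigr => j _; rewrite exp1n; case: ifP => // jk; rewrite /a jk.
Qed.

Lemma circ_flow a b : circ a b = a + expL circ p n gamma (Omega circ p n gamma a) b.
Proof.
(* [W] is a left inverse of g |-> [coef 1 (cpow g)], hence a two-sided one on the finite A. *)
have [f _ fK] := injF_bij (can_inj W_coef_cpow).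
have Wc x : coef 1 (cpow (W circ p n gamma x)) = x.
  by rewrite -[x in RHS]fK -[x in LHS]fK W_coef_cpow.
rewrite {1}circ_expL /Omega; case: pickP => [c /eqP <-|/(_ (coef 1 (cpow a)))] /=.
  by rewrite Wc.
by rewrite W_coef_cpow eqxx.
Qed.
End Nilpotent.
End Braces.

Theorem theorem12 (A : finZmodType) (circ : A -> A -> A) (p n k gamma : nat) :
  is_brace circ ->
  nilpotency_index circ k ->
  prime p -> #|A| = (p ^ n)%N ->
  (k < p)%N -> (n.+1 < p)%N ->
  primitive_root_mod (p ^ p) gamma ->
  forall a b : A,
    circ a b = a + expL circ p n gamma (Omega circ p n gamma a) b.
Proof.
move=> circB [nil [x [hx _]]] p_pr cardA kp np gammaP a b.
(* [bmem 0] is empty, so a nonzero element of A^[k-1] forces k >= 2. *)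
have bmem_pos i y : bmem circ i y -> (0 < i)%N by case=> //; lia.
have k1 : (1 < k)%N by have := bmem_pos _ _ hx; lia.
apply: (circ_flow circB k1 _ p_pr cardA kp gammaP) => [y|]; last exact: ltnW.
by rewrite /filt prednK; [exact: nil | exact: ltnW].
Qed.
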